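(* Let $\boldsymbol{A}\in\mathbb{R}^{I\times J_1J_2\cdots J_D}$ and $\boldsymbol{b}\in\mathbb{R}^I$. The Gaussian distribution $\mathcal{N}(\boldsymbol{w}_0,\boldsymbol{P}_0)$ of $(\boldsymbol{A},\boldsymbol{b})$-constrained tensors is described by a mean vector $\boldsymbol{w}_0$ such that $\boldsymbol{A}\,\boldsymbol{w}_0=\boldsymbol{b}$ and by a covariance matrix $\boldsymbol{P}_0$ such that the columns of $\sqrt{\boldsymbol{P}_0}$ span the right nullspace of $\boldsymbol{A}$.
   Context: A tensor $\mathcal{W}\in\mathbb{R}^{J_1\times\cdots\times J_D}$ (a $D$-dimensional real array) is called $(\boldsymbol{A},\boldsymbol{b})$-constrained if $\boldsymbol{A}\,\mathrm{vec}(\mathcal{W})=\boldsymbol{b}$; one writes $\boldsymbol{w}=\mathrm{vec}(\mathcal{W})\in\mathbb{R}^{J_1\cdots J_D}$ for its vectorization, and the Gaussian distribution is a distribution of $\boldsymbol{w}$. $\mathcal{N}(\boldsymbol{w}_0,\boldsymbol{P}_0)$ denotes the Gaussian distribution with mean vector $\boldsymbol{w}_0$ and covariance matrix $\boldsymbol{P}_0$. The square root matrix $\sqrt{\boldsymbol{P}_0}$ satisfies by definition $\boldsymbol{P}_0=\sqrt{\boldsymbol{P}_0}\,(\sqrt{\boldsymbol{P}_0})^T$. A sample of $\mathcal{N}(\boldsymbol{w}_0,\boldsymbol{P}_0)$ is $\boldsymbol{w}=\boldsymbol{w}_0+\sqrt{\boldsymbol{P}_0}\,\boldsymbol{x}$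 with $\boldsymbol{x}$ a sample of the standard normal distribution $\mathcal{N}(\boldsymbol{0},\boldsymbol{I})$. The right nullspace of $\boldsymbol{A}$ is the set of vectors $\boldsymbol{v}$ with $\boldsymbol{A}\boldsymbol{v}=\boldsymbol{0}$. *)

(* Defs.v *)
From HB Require Import structures.
From mathcomp Require Import all_boot all_order all_algebra.
From mathcomp Require Import all_classical all_reals all_analysis.

Set Implicit Arguments.
Unset Strict Implicit.
Unset Printing Implicit Defensive.

Import Order.TTheory GRing.Theory Num.Theory.
Import numFieldNormedType.Exports.

Local Open Scope classical_set_scope.
Local Open Scope ring_scope.

Definition multi_index (D : nat) (J : 'I_D -> nat) : finType :=
  {dffun forall d : 'I_D, 'I_(J d)}.

Definition tensor (R : Type) (D : nat) (J : 'I_D -> nat) : Type :=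
  {ffun multi_index J -> R}.

(* Column-major order, first index fastest: the entry of multi-index j is
   stored in position \sum_d j d * stride J d (see vec_linear_index). *)
Definition stride (D : nat) (J : 'I_D -> nat) (d : nat) : nat :=
  (\prod_(e < D | (e < d)%N) J e)%N.

Lemma digit_subproof (D : nat) (J : 'I_D -> nat)
    (i : 'I_(\prod_(d < D) J d)%N) (d : 'I_D) :
  (((i %/ stride J d) %% J d) < J d)%N.
Proof.
rewrite ltn_mod; have h : (0 < \prod_(d < D) J d)%N.
  by apply: leq_ltn_trans (ltn_ord i).
exact: (gt0_prodn h).
Qed.

Definition index_of (D : nat) (J : 'I_D -> nat)
    (i : 'I_(\prod_(d < D) J d)%N) : multi_index J :=
  [ffun d : 'I_D => Ordinal (digit_subproof i d)].

Definition vec (R : Type) (D : nat) (J : 'I_D -> nat) (W : tensor R J) :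
    'cV[R]_(\prod_(d < D) J d)%N :=
  \col_i W (index_of i).

Lemma strideS (D : nat) (J : 'I_D -> nat) (d : 'I_D) :
  stride J d.+1 = (J d * stride J d)%N.
Proof.
rewrite /stride (bigD1 d) //=; congr (_ * _)%N; apply: eq_bigl => e.
by rewrite ltnS [RHS]ltn_neqAle andbC.
Qed.

Lemma dvdn_stride (D : nat) (J : 'I_D -> nat) (d e : nat) :
  (d <= e)%N -> (stride J d %| stride J e)%N.
Proof.
move=> de; rewrite /stride [X in (_ %| X)%N](bigID (fun k : 'I_D => (k < d)%N)) /=.
apply: dvdn_mulr; rewrite [X in (_ %| X)%N](eq_bigl (fun k : 'I_D => (k < d)%N)) //.
by move=> k; rewrite andbC; case: ltnP => //= kd; rewrite (leq_trans kd de).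
Qed.

Lemma low_digits_lt (D : nat) (J : 'I_D -> nat) (j : multi_index J) (m : nat) :
  (m <= D)%N ->
  (\sum_(e < D | (e < m)%N) j e * stride J e < stride J m)%N.
Proof.
elim: m => [|m IH] mD; first by rewrite big_pred0 // /stride big_pred0.
pose d := Ordinal mD; have lt_m := IH (ltnW mD).
have -> : (\sum_(e < D | (e < m.+1)%N) j e * stride J e =
    j d * stride J m + \sum_(e < D | (e < m)%N) j e * stride J e)%N.
  rewrite (bigD1 d) //=; congr (_ + _)%N; apply: eq_bigl => e.
  by rewrite ltnS [RHS]ltn_neqAle andbC.
rewrite (strideS J d); apply: (@leq_trans ((j d).+1 * stride J m)%N).
  by rewrite mulSn addnC ltn_add2r.
by rewrite leq_mul2r ltn_ord orbT.
Qed.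

Lemma digit_linear_index (D : nat) (J : 'I_D -> nat) (j : multi_index J)
    (d : 'I_D) :
  ((\sum_(e < D) j e * stride J e) %/ stride J d %% J d = j d)%N.
Proof.
have lt := low_digits_lt j (ltnW (ltn_ord d)).
have s0 : (0 < stride J d)%N by exact: leq_ltn_trans (leq0n _) lt.
rewrite (bigID (fun e : 'I_D => (e < d)%N)) /= addnC.
rewrite (bigD1 d) /= ?ltnn //.
have /dvdnP [q ->] : (stride J d.+1 %| \sum_(i < D | ~~ (i < d)%N && (i != d))
    j i * stride J i)%N.
  apply: dvdn_sum => i /andP[+ id]; rewrite -leqNgt leq_eqVlt eq_sym.
  rewrite (negbTE (_ : (i : nat) != d)) //= => di.
  by apply: dvdn_mull; apply: dvdn_stride.
rewrite strideS mulnA -mulnDl divnMDl // (divn_small lt) addn0.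
by rewrite addnC modnMDl modn_small.
Qed.

Lemma vec_linear_index (R : Type) (D : nat) (J : 'I_D -> nat)
    (W : tensor R J) (j : multi_index J) (i : 'I_(\prod_(d < D) J d)%N) :
  (i : nat) = (\sum_(d < D) j d * stride J d)%N -> vec W i 0 = W j.
Proof.
move=> ij; rewrite mxE; congr (W _); apply/ffunP => d; apply: val_inj.
by rewrite ffunE /= ij digit_linear_index.
Qed.

Definition constrained (R : realType) (D : nat) (J : 'I_D -> nat) (I : nat)
    (A : 'M[R]_(I, \prod_(d < D) J d)) (b : 'cV[R]_I) (W : tensor R J) : Prop :=
  A *m vec W = b.

Definition right_nullspace (R : realType) (m n : nat) (A : 'M[R]_(m, n)) :
    set 'cV[R]_n :=
  [set v | A *m v = 0].

Definition column_span (R : realType) (n k : nat) (S : 'M[R]_(n, k)) :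
    set 'cV[R]_n :=
  [set S *m c | c in [set: 'cV[R]_k]].

Section gaussian.
Context (d : measure_display) (T : measurableType d) (R : realType)
  (P : probability T R).

(* The product rule over all index sets B is mutual independence. *)
Definition standard_normal (k : nat) (x : 'I_k -> {RV P >-> R}) : Prop :=
  (forall (i : 'I_k) (E : set R), measurable E ->
     distribution P (x i) E = normal_prob 0 1 E) /\
  (forall (B : {set 'I_k}) (E : 'I_k -> set R),
     (forall i, measurable (E i)) ->
     P (\big[setI/setT]_(i in B) (x i @^-1` E i)) =
     (\prod_(i in B) P (x i @^-1` E i))%E).

(* The mean need not be zero nor the covariance invertible: k is arbitrary, so
   singular covariance matrices, whose laws have no density, are included. *)
Definition gaussian_vector (n : nat) (w : T -> 'cV[R]_n) : Prop :=
  (forall i, measurable_fun [set: T] (fun t => w t i 0)) /\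
  exists (k : nat) (c : 'cV[R]_n) (S : 'M[R]_(n, k)) (x : 'I_k -> {RV P >-> R}),
    standard_normal x /\ {ae P, forall t, w t = c + S *m \col_i x i t}.

Definition has_mean (n : nat) (w : T -> 'cV[R]_n) (w0 : 'cV[R]_n) : Prop :=
  forall i, 'E_P[(fun t => w t i 0)%R]%E = (w0 i 0)%:E.

Definition has_covariance (n : nat) (w : T -> 'cV[R]_n) (P0 : 'M[R]_n) : Prop :=
  forall i j,
    covariance P (fun t => w t i 0) (fun t => w t j 0) = (P0 i j)%:E.

Definition normal_law (n : nat) (w : T -> 'cV[R]_n)
    (w0 : 'cV[R]_n) (P0 : 'M[R]_n) : Prop :=
  [/\ gaussian_vector w, has_mean w w0 & has_covariance w P0].

(* W is a random (A, b)-constrained tensor: almost all of its samples satisfy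
   the constraint, and no constrained tensor is excluded, i.e. each one lies in
   the topological support of the law of W. *)
Definition law_of_constrained_tensors (D : nat) (J : 'I_D -> nat) (I : nat)
    (A : 'M[R]_(I, \prod_(d < D) J d)) (b : 'cV[R]_I) (W : T -> tensor R J) :
    Prop :=
  {ae P, forall t, constrained A b (W t)} /\
  (forall V : tensor R J, constrained A b V ->
     forall e : R, 0 < e -> (0 < P [set t | forall j, (`|W t j - V j| < e)%R])%E).

End gaussian.

(* Main.v *)
(* Only second moments and the support of the Gaussian law matter.  The entries
   of w - w0 are square integrable because the covariance P0 = L L^T is finite,
   and Var (v w) = |v L|^2, so a linear form v is almost surely constant on w
   iff v L = 0.  Applied to the rows of A, this turns "A w = b almost surely"
   into A w0 = b and A L = 0.  Applied to linear forms cutting out span L, it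
   shows that the samples stay in w0 + span L, so null vectors of A approximated
   by samples lie in span L.  Conversely, for a representation w = c + S x, the
   forms vanishing on span S are constant on w, whence they also vanish on
   span L: a constrained tensor is c + S y for some y, and it lies in the support
   since x meets every box around y with positive probability. *)

Require Import Defs.
From mathcomp Require Import all_boot all_order all_algebra.
From mathcomp Require Import all_classical all_reals all_analysis.
From mathcomp Require Import measurable_realfun lra.

Set Implicit Arguments.
Unset Strict Implicit.
Unset Printing Implicit Defensive.

Import Order.TTheory GRing.Theory Num.Theory.
Import numFieldNormedType.Exports.

Local Open Scope classical_set_scope.
Local Open Scope ring_scope.

(** * Column spans as zero sets of linear forms *)

Lemma tr_cokermx_mul (F : realType) (n k : nat) (L : 'M[F]_(n, k)) :
  (cokermx L^T)^T *m L = 0.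
Proof. by rewrite -[X in _ *m X]trmxK -trmx_mul mulmx_coker trmx0. Qed.

(** Transposing turns the column span into the row space of [L^T], and membership in a row space
    means being killed by its cokernel matrix. This provides the linear forms that are tested on
    samples below. *)
Lemma column_span_cokerP (F : realType) (n k : nat) (L : 'M[F]_(n, k)) (u : 'cV[F]_n) :
  column_span L u <-> (cokermx L^T)^T *m u = 0.
Proof.
split=> [[c _ <-]|Ku].
  by rewrite mulmxA tr_cokermx_mul mul0mx.
have /submxP[c uE] : (u^T <= L^T)%MS.
  by rewrite submxE -[cokermx _]trmxK -trmx_mul Ku trmx0.
by exists c^T => //; rewrite -[L]trmxK -trmx_mul -uE trmxK.
Qed.

(** * Vectorization as a bijection *)

Lemma index_of_bij (D : nat) (J : 'I_D -> nat) : bijective (@index_of D J).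
Proof.
have lt (j : multi_index J) :
    (\sum_(d < D) j d * stride J d < \prod_(d < D) J d)%N.
  have := low_digits_lt j (leqnn D).
  rewrite /stride (eq_bigl xpredT) => [|d]; last by rewrite ltn_ord.
  by rewrite [X in (_ < X)%N](eq_bigl xpredT) // => d; rewrite ltn_ord.
pose f j := Ordinal (lt j).
have fK : cancel f (@index_of D J).
  by move=> j; apply/ffunP => d; apply: val_inj; rewrite ffunE /= digit_linear_index.
(* [index_of] undoes the linear index [f], so [f] is injective; both finite types have
   [\prod_(d < D) J d] elements. *)
have fb : bijective f.
  apply: inj_card_bij; first exact: can_inj fK.
  rewrite card_ord card_dep_ffun foldrE big_map big_enum /=.
  by apply: eq_leq; apply: eq_bigr => d _; rewrite card_ord.
by apply: (bij_can_bij fb); exact: fK.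
Qed.

Lemma vec_surj (F : realType) (D : nat) (J : 'I_D -> nat)
    (u : 'cV[F]_(\prod_(d < D) J d)) :
  exists V : tensor F J, vec V = u.
Proof.
have [f fK _] := index_of_bij J; exists [ffun j => u (f j) 0].
by apply/colP => i; rewrite mxE ffunE fK.
Qed.

(** * Second moments and almost surely constant linear forms *)

Section square_integrable_vector.
Context (d : measure_display) (T : measurableType d) (R : realType)
  (P : probability T R) (n : nat) (w : T -> 'cV[R]_n) (w0 : 'cV[R]_n)
  (P0 : 'M[R]_n).
Hypotheses (mw : forall i, measurable_fun [set: T] (fun t => w t i 0))
  (w_mean : has_mean P w w0) (w_cov : has_covariance P w P0).

Local Notation u i := (fun t => w t i 0 - w0 i 0).

Lemma measurable_centered i : measurable_fun [set: T] (u i).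
Proof. by apply: measurable_funD. Qed.

Lemma integral_centeredM i j :
  (\int[P]_t (u i t * u j t)%:E = (P0 i j)%:E)%E.
Proof. by have := w_cov i j; rewrite unlock !w_mean /= unlock. Qed.

(** Squares are nonnegative with the finite integral [P0 i i]; mixed products follow by domination,
    [|x y| <= x^2 + y^2]. *)
Lemma integrable_centeredM i j :
  P.-integrable [set: T] (fun t => (u i t * u j t)%:E).
Proof.
have mu2 a b : measurable_fun [set: T] (fun t => (u a t * u b t)%:E).
  by apply/measurable_EFinP; apply: measurable_funM; exact: measurable_centered.
have isq a : P.-integrable [set: T] (fun t => (u a t * u a t)%:E).
  apply/integrableP; split; first exact: mu2.
  under eq_integral do rewrite gee0_abs ?lee_fin -?expr2 ?sqr_ge0//.
  by under eq_integral do rewrite expr2; rewrite integral_centeredM ltry.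
apply: (le_integrable _ _ _ (integrableD _ (isq i) (isq j))) => //.
move=> t _; rewrite lee_fin; move: (u i t) (u j t) => x y /=.
rewrite normrM; apply: le_trans (ler_norm _); rewrite -!expr2 -(real_normK (num_real x)).
rewrite -(real_normK (num_real y)); have := mulr_ge0 (normr_ge0 x) (normr_ge0 y).
by have := sqr_ge0 (`|x| - `|y|); nra.
Qed.

(** Domination by [x^2 + 1], integrable because [P] is finite. *)
Lemma integrable_centered i : P.-integrable [set: T] (fun t => (u i t)%:E).
Proof.
have i1 : P.-integrable [set: T] (cst 1%:E : T -> \bar R).
  exact: finite_measure_integrable_cst.
apply: (le_integrable _ _ _ (integrableD _ (integrable_centeredM i i) i1)) => //.
  by apply/measurable_EFinP; exact: measurable_centered.
move=> t _; rewrite lee_fin; move: (u i t) => x /=.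
apply: le_trans (ler_norm _); rewrite -expr2 -(real_normK (num_real x)).
by have := sqr_ge0 (`|x| - 1); have := normr_ge0 x; nra.
Qed.

(** The value of the mean alone does not make [w] integrable; integrability comes from writing [w]
    as its centered part plus a constant, and only then may the integral be split. *)
Lemma integral_centered i : (\int[P]_t (u i t)%:E = 0)%E.
Proof.
have iw : P.-integrable [set: T] (fun t => (w t i 0)%:E).
  apply: (@eq_integrable _ _ _ _ _ _ (fun t => (u i t)%:E + (w0 i 0)%:E)%E) => //.
    by move=> t _; rewrite -EFinD subrK.
  apply: integrableD => //; first exact: integrable_centered.
  exact: finite_measure_integrable_cst.
have := w_mean i; rewrite unlock => Ew.
under eq_integral do rewrite EFinB.
rewrite integralB//; last first.
  exact: finite_measure_integrable_cst.
by rewrite Ew integral_cst//= probability_setT mule1 -EFinB subrr.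
Qed.

Lemma mul_centeredE (p : nat) (B : 'M[R]_(p, n)) t i :
  (B *m w t - B *m w0) i 0 = \sum_j B i j * u j t.
Proof. by rewrite -mulmxBr mxE; apply: eq_bigr => j _; rewrite !mxE. Qed.

Lemma ae_mul_mean (p : nat) (B : 'M[R]_(p, n)) (a : 'cV[R]_p) :
  {ae P, forall t, B *m w t = a} -> B *m w0 = a.
Proof.
move=> Bwa; apply/colP => i.
have : (\int[P]_t ((\sum_j B i j * u j t)%:E) = (a i 0 - (B *m w0) i 0)%:E)%E.
  rewrite (ae_eq_integral (cst (a i 0 - (B *m w0) i 0)%:E))//.
  - by rewrite integral_cst//= probability_setT mule1.
  - apply/measurable_EFinP; apply: measurable_sum => j.
    by apply: measurable_funM => //; exact: measurable_centered.
  - by apply: filterS Bwa => t /= Bwa _; rewrite -mul_centeredE Bwa !mxE.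
under eq_integral do rewrite -sumEFin.
rewrite integral_sum//; last first.
  by move=> j; apply: (integrableZl measurableT (B i j) (integrable_centered j)).
rewrite big1; last first.
  move=> j _; under eq_integral do rewrite EFinM.
  by rewrite integralZl ?integral_centered ?mule0//; exact: integrable_centered.
by move=> [] /esym/eqP; rewrite subr_eq0 => /eqP.
Qed.

Lemma ae_mul_centered (k p : nat) (L : 'M[R]_(n, k)) (B : 'M[R]_(p, n)) :
  P0 = L *m L^T ->
  {ae P, forall t, B *m w t = B *m w0} <-> B *m L = 0.
Proof.
move=> P0E.
pose f i t := \sum_j B i j * u j t.
have mf i : measurable_fun [set: T] (f i).
  apply: measurable_sum => j.
  by apply: measurable_funM => //; exact: measurable_centered.
(* The absolute value gives the integral the form for which vanishing is equivalent to vanishing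
   almost everywhere. *)
have var i : (\int[P]_t `|(f i t ^+ 2)%:E| = (\sum_j (B *m L) i j ^+ 2)%:E)%E.
  transitivity (\int[P]_t \sum_j \sum_l (B i j * B i l * (u j t * u l t))%:E)%E.
    apply: eq_integral => t _; rewrite gee0_abs ?lee_fin ?sqr_ge0//.
    rewrite expr2 /f mulr_suml -sumEFin; apply: eq_bigr => j _.
    rewrite mulr_sumr -sumEFin; apply: eq_bigr => l _.
    by rewrite mulrACA.
  have iM j l : P.-integrable [set: T] (fun t => (B i j * B i l * (u j t * u l t))%:E).
    by apply: (integrableZl measurableT (B i j * B i l) (integrable_centeredM j l)).
  rewrite integral_sum//; last by move=> j; apply: (integrable_sum measurableT) => l _; exact: iM.
  (* Both sides are the diagonal entry of [(B *m L) *m (B *m L)^T]. *)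
  have -> : \sum_j (B *m L) i j ^+ 2 = (B *m P0 *m B^T) i i.
    rewrite P0E mulmxA -mulmxA -trmx_mul mxE.
    by apply: eq_bigr => j _; rewrite [X in _ = _ * X]mxE expr2.
  rewrite -mulmxA mxE -sumEFin; apply: eq_bigr => j _.
  rewrite integral_sum// mxE mulr_sumr -sumEFin; apply: eq_bigr => l _.
  under eq_integral do rewrite EFinM.
  rewrite integralZl ?integral_centeredM//; last exact: integrable_centeredM.
  by rewrite -EFinM [B^T _ _]mxE; congr _%:E; rewrite -mulrA; congr (_ * _); rewrite mulrC.
split=> [Bw|BL].
  apply/matrixP => i j; rewrite [RHS]mxE.
  have : (\sum_j (B *m L) i j ^+ 2)%:E = 0%E.
    rewrite -var; apply/ae_eq_integral_abs => //.
      by apply/measurable_EFinP; exact: measurable_funX.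
    apply: filterS Bw => t Bw _ /=.
    by rewrite /f -mul_centeredE Bw subrr mxE expr0n.
  move=> [] /psumr_eq0P s0; apply/eqP; rewrite -sqrf_eq0; apply/eqP.
  by apply: s0 => // l _; exact: sqr_ge0.
have f0 : {ae P, forall t, forall i, f i t = 0}.
  apply: filter_forall => i.
  have : (\int[P]_t `|(f i t ^+ 2)%:E| = 0)%E.
    by rewrite var BL big1// => j _; rewrite mxE expr0n.
  have mf2 : measurable_fun [set: T] (EFin \o (fun t => f i t ^+ 2)).
    by apply/measurable_EFinP; exact: measurable_funX.
  move=> /(proj1 (ae_eq_integral_abs P measurableT mf2)).
  apply: filterS => t /(_ Logic.I) [] /eqP.
  by rewrite sqrf_eq0 => /eqP.
apply: filterS f0 => t f0; apply/eqP; rewrite -subr_eq0; apply/eqP/colP => i.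
by rewrite mul_centeredE [LHS]f0 mxE.
Qed.

End square_integrable_vector.

(** * Positive probability of boxes *)

Lemma normal_prob_ball_gt0 (R : realType) (m s y r : R) :
  s != 0 -> 0 < r -> (0 < normal_prob m s (ball y r))%E.
Proof.
move=> s0 r0; have mb : measurable (ball y r) by exact: measurable_ball.
rewrite lt0e measure_ge0 andbT; apply/negP => /eqP.
have mpdf : measurable_fun (ball y r) (EFin \o normal_pdf m s).
  by apply/measurable_EFinP/measurable_funTS; exact: measurable_normal_pdf.
rewrite /normal_prob.
under eq_integral => z _ do
  rewrite -(@gee0_abs _ (normal_pdf m s z)%:E) ?lee_fin ?normal_pdf_ge0//.
(* The density vanishes nowhere, so zero mass would make the ball Lebesgue-null, although its length
   is [r *+ 2]. *)
move=> /(proj1 (ae_eq_integral_abs lebesgue_measure mb mpdf)) pdf0.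
suff : lebesgue_measure (ball y r) = 0%E :> \bar R.
  by rewrite lebesgue_measure_ball ?ltW// => -[] /eqP; rewrite mulrn_eq0/= gt_eqF.
apply/negligibleP => //; apply: negligibleS pdf0 => z yz /=.
move=> /(_ yz) [] /eqP; rewrite normal_pdfE// mulf_eq0.
by rewrite !gt_eqF ?expR_gt0// normal_peak_gt0.
Qed.

(** Independence over the full index set factors the probability of the box into positive
    probabilities of balls. *)
Lemma standard_normal_box_gt0 (d : measure_display) (T : measurableType d)
    (R : realType) (P : probability T R) (k : nat) (x : 'I_k -> {RV P >-> R})
    (y : 'I_k -> R) (r : R) :
  standard_normal x -> 0 < r ->
  measurable [set t | forall i, `|x i t - y i| < r] /\
  (0 < P [set t | forall i, (`|x i t - y i| < r)%R])%E.
Proof.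
move=> [xN x_indep] r0.
have mE i : measurable (ball (y i) r) by exact: measurable_ball.
have -> : [set t | forall i, `|x i t - y i| < r] =
    \big[setI/setT]_(i in [set: 'I_k]%SET) (x i @^-1` ball (y i) r).
  rewrite -bigcap_seq_cond; apply/seteqP; split=> t /= h i.
    by move=> _; rewrite /ball /= distrC.
  by rewrite distrC; apply: h; rewrite /= mem_index_enum finset.in_setT.
split.
  apply: bigsetI_measurable => i _.
  by rewrite -[X in measurable X]setTI; exact: measurable_funP.
rewrite x_indep//; elim/big_rec : _ => // i z _ z0.
by rewrite mule_gt0//; have := xN i _ (mE i); rewrite /distribution /pushforward => ->;
   rewrite normal_prob_ball_gt0// oner_neq0.
Qed.

Lemma ae_exists (d : measure_display) (T : measurableType d) (R : realType)
    (P : probability T R) (Q : T -> Prop) (E : set T) :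
  measurable E -> {ae P, forall t, Q t} -> (0 < P E)%E -> exists2 t, E t & Q t.
Proof.
move=> mE aeQ PE; apply/not_exists2P => noQ.
have /(negligibleP _ mE) PE0 : P.-negligible E.
  by apply: negligibleS aeQ => t Et /=; have [] := noQ t.
by rewrite PE0 ltxx in PE.
Qed.

(** * Constraint and support in terms of mean and square root *)

Theorem theorem3p1 (R : realType) (D : nat) (J : 'I_D -> nat) (I : nat)
    (A : 'M[R]_(I, (\prod_(d < D) J d)%N)) (b : 'cV[R]_I)
    (w0 : 'cV[R]_(\prod_(d < D) J d)%N) (P0 : 'M[R]_(\prod_(d < D) J d)%N)
    (k : nat) (sqrtP0 : 'M[R]_((\prod_(d < D) J d)%N, k))
    (sqrtP0E : P0 = sqrtP0 *m sqrtP0^T)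
    (disp : measure_display) (T : measurableType disp) (P : probability T R)
    (W : T -> tensor R J) (W_normal : normal_law P (fun t => vec (W t)) w0 P0) :
  law_of_constrained_tensors P A b W <->
  A *m w0 = b /\ column_span sqrtP0 = right_nullspace A.
Proof.
pose w t := vec (W t).
have [[mw [l [c [S [x [x_normal wE]]]]]] w_mean w_cov] := W_normal.
have ae_mulE p (B : 'M[R]_(p, _)) :=
  @ae_mul_centered _ _ _ _ _ w w0 P0 mw w_mean w_cov _ _ sqrtP0 B sqrtP0E.
have ae_mean p (B : 'M[R]_(p, _)) a :=
  @ae_mul_mean _ _ _ _ _ w w0 P0 mw w_mean w_cov _ B a.
(* Since [index_of] is onto, closeness of tensors can be read on their vectorizations. *)
have closeE (V : tensor R J) (e : R) :
    [set t | forall j, `|W t j - V j| < e] =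
    [set t | forall i, `|w t i 0 - vec V i 0| < e].
  have [g _ Kg] := index_of_bij J.
  apply/seteqP; split=> t /= h i; first by rewrite /w !mxE.
  by have := h (g i); rewrite /w !mxE Kg.
have mclose (V : tensor R J) (e : R) :
    measurable [set t | forall j, `|W t j - V j| < e].
  rewrite closeE (_ : [set t | _] =
      \big[setI/setT]_i [set t | `|w t i 0 - vec V i 0| < e]); last first.
    rewrite -bigcap_seq; apply/seteqP; split=> t /= h i; first by move=> _; exact: h.
    by apply: h; rewrite /= mem_index_enum.
  apply: bigsetI_measurable => i _; rewrite -[X in measurable X]setTI.
  have -> : [set t | `|w t i 0 - vec V i 0| < e] =
      (fun t => w t i 0) @^-1` ball (vec V i 0) e.
    by apply/seteqP; split=> t /=; rewrite /ball /= distrC.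
  by apply: mw => //; exact: measurable_ball.
(* The rows of [K] cut out the span of [sqrtP0], so [Kw] confines almost all samples to [w0] plus
   that span. *)
set K := (cokermx sqrtP0^T)^T.
have KL : K *m sqrtP0 = 0 := tr_cokermx_mul sqrtP0.
have Kw : {ae P, forall t, K *m w t = K *m w0} by apply/ae_mulE.
split=> [[aeA supp]|[Aw0 spanL]].
  have Aw0 : A *m w0 = b by exact: ae_mean aeA.
  have AL : A *m sqrtP0 = 0 by apply/ae_mulE; rewrite Aw0.
  split=> //; apply/seteqP; split=> [_ [y _ <-]|v /= Av].
    by rewrite /right_nullspace /= mulmxA AL mul0mx.
  apply/column_span_cokerP/colP => i; rewrite [RHS]mxE; apply/eqP; rewrite -normr_le0.
  (* Shifting the mean by a null vector gives a constrained tensor, which the support condition lets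
     samples approximate; this forces [K *m v] to be arbitrarily small. *)
  have [V VE] := vec_surj (w0 + v).
  have AV : constrained A b V by rewrite /constrained VE mulmxDr Aw0 Av addr0.
  apply/ler_addgt0Pl => e e0; rewrite addr0.
  (* Samples within [e / (M + 1)] change the [i]-th form by at most [e]; adding 1 covers [M = 0]. *)
  pose M := \sum_j `|K i j|; have M0 : 0 <= M by exact: sumr_ge0.
  have M1 : 0 < M + 1 by rewrite ltr_wpDl.
  have [t] := ae_exists (mclose V _) Kw (supp V AV (e / (M + 1)) (divr_gt0 e0 M1)).
  rewrite -[X in X -> _]/([set t | _] t) closeE /= VE => close Kt.
  have -> : K *m v = - (K *m (w t - (w0 + v))).
    by rewrite mulmxBr Kt mulmxDr opprB addrAC subrr add0r.
  rewrite mxE normrN mxE (le_trans (ler_norm_sum _ _ _))//.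
  apply: (@le_trans _ _ (\sum_j `|K i j| * (e / (M + 1)))).
    apply: ler_sum => j _; rewrite normrM ler_wpM2l//.
    by have := close j; rewrite !mxE => /ltW.
  by rewrite -mulr_suml mulrCA ger_pMr// ler_pdivrMr// mul1r lerDl.
have AL : A *m sqrtP0 = 0.
  apply/matrixP => i j; have : right_nullspace A (col j sqrtP0).
    by rewrite -spanL; exists (delta_mx j 0) => //; rewrite colE.
  by rewrite /right_nullspace /= colE mulmxA -colE => /colP /(_ i); rewrite !mxE.
split.
  have /ae_mulE : A *m sqrtP0 = 0 by [].
  by apply: filterS => t; rewrite Aw0.
move=> V AV e e0; rewrite closeE.
(* [c] and [S] need not equal [w0] and [sqrtP0]. The forms [K'] vanishing on the span of [S] are
   constant on samples, which ties the two descriptions together. *)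
pose K' := (cokermx S^T)^T.
have K'w : {ae P, forall t, K' *m w t = K' *m c}.
  by apply: filterS wE => t; rewrite /w => ->; rewrite mulmxDr mulmxA tr_cokermx_mul mul0mx addr0.
have K'w0 : K' *m w0 = K' *m c by exact: ae_mean K'w.
have K'L : K' *m sqrtP0 = 0 by apply/ae_mulE; rewrite K'w0.
have : column_span sqrtP0 (vec V - w0).
  by rewrite spanL /right_nullspace /= mulmxBr Aw0 AV subrr.
move=> [z _ zE].
have : column_span S (vec V - c).
  apply/column_span_cokerP; rewrite -/K' mulmxBr -K'w0 -mulmxBr -zE mulmxA K'L mul0mx//.
move=> [y _ yE].
(* Summing over all entries bounds every row sum, so one box radius serves all coordinates. *)
pose M := \sum_i \sum_j `|S i j|.
have M0 : 0 <= M by apply: sumr_ge0 => i _; exact: sumr_ge0.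
have M1 : 0 < M + 1 by rewrite ltr_wpDl.
have [mbox box0] := standard_normal_box_gt0 (fun i => y i 0) x_normal (divr_gt0 e0 M1).
apply: (lt_le_trans box0).
have [N [mN PN wN]] := wE.
(* Enlarging the target by the null set where the representation fails turns the almost sure
   inclusion of the box into a pointwise one. *)
rewrite -[leRHS](measureU0 _ mN PN)//; last by rewrite -closeE; exact: mclose.
apply: le_measure; rewrite ?inE//.
  by apply: measurableU => //; rewrite -closeE; exact: mclose.
move=> t /= box; have [wt|wt] := pselect (vec (W t) = c + S *m \col_i x i t); last first.
  by right; apply: wN.
left=> i; rewrite /w wt.
have -> : vec V = c + S *m y by rewrite yE addrC subrK.
have -> : (c + S *m \col_i x i t) i 0 - (c + S *m y) i 0 =
    \sum_j S i j * (x j t - y j 0).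
  rewrite !mxE opprD addrACA subrr add0r -sumrB; apply: eq_bigr => j _.
  by rewrite !mxE mulrBr.
rewrite (le_lt_trans (ler_norm_sum _ _ _))//.
apply: (@le_lt_trans _ _ (\sum_j `|S i j| * (e / (M + 1)))).
  by apply: ler_sum => j _; rewrite normrM ler_wpM2l// ltW.
rewrite -mulr_suml mulrCA gtr_pMr// ltr_pdivrMr// mul1r.
apply: (@le_lt_trans _ _ M); last by rewrite ltrDl.
by rewrite /M (bigD1 i)//= lerDl; apply: sumr_ge0 => j _; exact: sumr_ge0.
Qed.
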